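(* Let $G$ and $H$ be two finite digraphs satisfying $G<H$ in the homomorphism order, where the core of $H$ is connected and contains a cycle. Then the interval $[G,H]$ is universal.
   Context: All digraphs are finite. A digraph $G$ is a pair $(V(G),A(G))$ with $V(G)$ a set of vertices and $A(G)$ a binary irreflexive relation on $V(G)$ (the arcs; the arc $(u,v)$ is written $uv$). Connectedness of a digraph ignores arc directions. A path is a digraph consisting of a sequence of different vertices $v_0,\dots,v_k$ together with a sequence of different arcs $e_1,\dots,e_k$ such that each $e_i$ is an arc joining $v_{i-1}$ and $v_i$ (in either direction, i.e. $e_i=v_{i-1}v_i$ or $e_i=v_iv_{i-1}$). A cycle is defined analogously but with $v_0=v_k$ (and $k\ge 1$); arcs may again be oriented in either direction, so a cycle need not be a directed cycle. A homomorphism $f:G\to H$ of digraphs is a map $f:V(G)\to V(H)$ such that $uv\in A(G)$ implies $f(u)f(v)\in A(H)$. Write $G\le H$ if there is a homomorphism from $G$ to $H$, and $G<H$ if $G\le H$ and $H\not\le G$. Digraphs $G,H$ are homomorphically equivalent if $G\le H$ and $H\le G$. The relation $\le$ is a quasiorder on finite digraphs, which becomes a partial order (the homomorphism order) on homomorphic equivalence classes. The core of a digraph is its minimal homomorphically equivalent subgraph (unique up to isomorphism). The interval $[G,H]$ consists of all finite digraphs $X$ with $G\le X\le H$, ordered by $\le$ (considered up to homomorphic equivalence). An embedding of a partial order $(\mathcal{P}_1,\le_1)$ into $(\mathcal{P}_2,\le_2)$ is a map $\Phi:\mathcal{P}_1\to\mathcal{P}_2$ such that for all $a,b\in\mathcal{P}_1$,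 $a\le_1 b$ if and only if $\Phi(a)\le_2\Phi(b)$. A partial order is universal if every countable partial order can be embedded into it. *)

(* Defs.v *)
From HB Require Import structures.
From mathcomp Require Import all_boot.
From Stdlib Require Relations.Relation_Definitions.

Set Implicit Arguments.
Unset Strict Implicit.
Unset Printing Implicit Defensive.

Record digraph := Digraph {
  vertex :> finType;
  arc : rel vertex;
  arc_irr : irreflexive arc
}.

Definition hom_le (G H : digraph) : Prop :=
  exists f : G -> H, {homo f : u v / arc u v >-> arc u v}.

Definition hom_lt (G H : digraph) : Prop := hom_le G H /\ ~ hom_le H G.

Definition hom_equiv (G H : digraph) : Prop := hom_le G H /\ hom_le H G.

Definition connected (G : digraph) : Prop :=
  forall x y : G, connect [rel u v | arc u v || arc v u] x y.

(* [e i] is the arc joining [v i] and [v i.+1].  Since the arcs, and not only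
   the vertices, are required to be distinct, a pair of opposite arcs uv, vu
   is a cycle (with k = 2), but a single arc traversed back and forth is not. *)
Definition is_cycle (G : digraph) (k : nat) (v : nat -> G) (e : nat -> G * G)
    : Prop :=
  [/\ 0 < k, v k = v 0,
      {in gtn k &, injective v},
      {in gtn k &, injective e} &
      forall i, i < k ->
        arc (e i).1 (e i).2 /\
        (e i = (v i, v i.+1) \/ e i = (v i.+1, v i))].

Definition contains_cycle (G : digraph) : Prop :=
  exists k (v : nat -> G) (e : nat -> G * G), is_cycle k v e.

(* Subgraphs need not be induced. *)
Record subgraph (H : digraph) := Subgraph {
  sub_vertices : {set H};
  sub_arcs : {set H * H};
  sub_arcsP : forall a, a \in sub_arcs ->
    [/\ arc a.1 a.2, a.1 \in sub_vertices & a.2 \in sub_vertices]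
}.

Section SubgraphDigraph.
Variables (H : digraph) (C : subgraph H).

Definition sub_arc : rel {x : H | x \in sub_vertices C} :=
  [rel x y | (val x, val y) \in sub_arcs C].

Lemma sub_arc_irr : irreflexive sub_arc.
Proof.
move=> x; apply/negP => /sub_arcsP [].
by rewrite /= arc_irr.
Qed.

Definition digraph_of_subgraph : digraph := Digraph sub_arc_irr.

End SubgraphDigraph.

Coercion digraph_of_subgraph : subgraph >-> digraph.

Definition subgraph_le (H : digraph) (K C : subgraph H) : Prop :=
  sub_vertices K \subset sub_vertices C /\ sub_arcs K \subset sub_arcs C.

Definition is_core (H : digraph) (C : subgraph H) : Prop :=
  hom_equiv C H /\
  forall K : subgraph H, subgraph_le K C -> hom_equiv K H -> subgraph_le C K.

Definition interval (G H : digraph) : Type :=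
  {X : digraph | hom_le G X /\ hom_le X H}.

Definition interval_le (G H : digraph) (X Y : interval G H) : Prop :=
  hom_le (sval X) (sval Y).

Definition countable (P : Type) : Prop := exists c : P -> nat, injective c.

Definition is_embedding (P Q : Type) (leP : P -> P -> Prop)
    (leQ : Q -> Q -> Prop) (Phi : P -> Q) : Prop :=
  forall a b, leP a b <-> leQ (Phi a) (Phi b).

(* [leQ] may be a mere quasiorder: [Phi] then picks representatives, and such a
   map is the same thing as an embedding into the partial order of equivalence
   classes of [leQ]. *)
Definition universal (Q : Type) (leQ : Q -> Q -> Prop) : Prop :=
  forall (P : Type) (leP : P -> P -> Prop),
    countable P -> Relation_Definitions.order P leP ->
    exists Phi : P -> Q, is_embedding leP leQ Phi.

(* Main.v *)
Require Import Defs.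
From HB Require Import structures.
From mathcomp Require Import all_boot fingroup perm boolp.
(* [arc] must denote the arc relation of a digraph and not [path.arc]. *)
Import Defs.

Set Implicit Arguments.
Unset Strict Implicit.
Unset Printing Implicit Defensive.

(** The homomorphism order has binary meets (products) and joins (disjoint
    unions).  It is therefore enough to find digraphs [K 0], [K 1], ... and a
    digraph [A] above [G] that are independent over [C]: for no bound [m] and no
    set [S] of indices below [m] is the meet of [C] and of the [K i] with [i] in
    [S] below the join of [A] and of the [K i] with [i < m] outside [S].  A countable order on the
    natural numbers is then represented by attaching to [i] the join of [G] and
    of the [X j] with [j <= i] numerically and [j] below [i] in the order,
    where [X j] is the meet of [C] and of the [K l] with [l <= j] numerically
    and [l] above [j] in the order ([universal_of_independent]).

    The digraphs [K i] come from one construction.  Let [uv] be an arc of the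
    core [C] that lies on a cycle.  For a digraph [Q], let [twist u v Q] consist
    of one copy of [C] minus [uv] for each vertex of [Q], in which the arc [uv]
    goes from copy [i] to copy [j] when [ij] is an arc of [Q].  It projects to
    [C]; conversely [C] does not map to it, because an endomorphism of a core is
    an automorphism, so that a homomorphism would yield a section of the
    projection; a section stays in the same copy along the rest of the cycle,
    and then [uv] would produce a loop of [Q] ([core_not_le_twist]).

    Take for [Q] a shift digraph, on increasing sequences of length [k + 1].
    Two properties of it matter.

    - Its chromatic number is large ([shift_monochromatic_arc]).  Given a
      homomorphism from the product of [Z] and [twist u v Q] to [W], colour a
      vertex of [Q] by the map that it induces from the product of [Z] and [C]
      to [W]: two adjacent vertices of the same colour show that this map is a
      homomorphism ([twist_cancel]).
    - Its subgraphs on at most [k] vertices are bipartite.  Hence a small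
      digraph cannot use [twist u v Q] for more than the single digraph
      [D = twist u v K2], which [C] does not map to ([twist_K2_absorb]).

    Choosing the parameters of [K m] large enough for all the meets and joins
    of [K 0], ..., [K (m - 1)], the first property removes [K m] from the meet
    and the second removes it from the join of [G], [D] and the other [K i]
    ([meet_not_le_join]).  What remains is that [C], being connected, maps
    neither to [G] nor to [D]. *)

(** * Meets and joins in the homomorphism order *)

Lemma hom_le_refl (G : digraph) : hom_le G G.
Proof. by exists id. Qed.

Lemma hom_le_trans (G H K : digraph) : hom_le G H -> hom_le H K -> hom_le G K.
Proof.
by move=> [f fP] [g gP]; exists (g \o f) => x y xy; apply: gP; apply: fP.
Qed.

Definition prod_arc (A B : digraph) : rel (A * B) :=
  fun p q => arc p.1 q.1 && arc p.2 q.2.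

Lemma prod_arc_irr (A B : digraph) : irreflexive (@prod_arc A B).
Proof. by move=> p; rewrite /prod_arc arc_irr. Qed.

Definition prod_digraph (A B : digraph) := Digraph (@prod_arc_irr A B).

Lemma prod_le1 (A B : digraph) : hom_le (prod_digraph A B) A.
Proof. by exists fst => p q /andP[]. Qed.

Lemma prod_le2 (A B : digraph) : hom_le (prod_digraph A B) B.
Proof. by exists snd => p q /andP[]. Qed.

Lemma le_prod (Z A B : digraph) :
  hom_le Z A -> hom_le Z B -> hom_le Z (prod_digraph A B).
Proof.
move=> [f fP] [g gP]; exists (fun z => (f z, g z)) => x y xy.
by apply/andP; split; [apply: fP | apply: gP].
Qed.

Definition sum_arc (A B : digraph) : rel (A + B) := fun p q =>
  match p, q with
  | inl x, inl y => arc x y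
  | inr x, inr y => arc x y
  | _, _ => false
  end.

Lemma sum_arc_irr (A B : digraph) : irreflexive (@sum_arc A B).
Proof. by case=> x /=; rewrite arc_irr. Qed.

Definition sum_digraph (A B : digraph) := Digraph (@sum_arc_irr A B).

Lemma le_sum1 (A B : digraph) : hom_le A (sum_digraph A B).
Proof. by exists inl. Qed.

Lemma le_sum2 (A B : digraph) : hom_le B (sum_digraph A B).
Proof. by exists inr. Qed.

Lemma sum_le (A B Z : digraph) :
  hom_le A Z -> hom_le B Z -> hom_le (sum_digraph A B) Z.
Proof.
move=> [f fP] [g gP].
exists (fun p => match p with inl x => f x | inr y => g y end).
by case=> x [] y //= xy; [apply: fP | apply: gP].
Qed.

(** A connected digraph cannot have vertices in both summands, since no arc
    joins them. *)
Lemma connected_le_sum (Z A B : digraph) (z : Z) :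
  connected Z -> hom_le Z (sum_digraph A B) -> hom_le Z A \/ hom_le Z B.
Proof.
move=> Zconn [f fP].
pose left (p : A + B) := if p is inl _ then true else false.
have step x y : arc x y -> left (f x) = left (f y).
  by move/fP; rewrite /left /=; case: (f x) (f y) => [a|a] [b|b].
have side x : left (f x) = left (f z).
  case/connectP: (Zconn z x) => p + ->; elim: p z {Zconn} => //= y p IHp z.
  by case/andP=> /orP[] /step zy /IHp ->.
case: (boolP (left (f z))) => fz; [left|right].
- have fl x : {a | f x = inl a}.
    by move: fz; rewrite -(side x); case: (f x) => // a _; exists a.
  exists (fun x => sval (fl x)) => x y /fP.
  by rewrite {1}(svalP (fl x)) {1}(svalP (fl y)).
- have fr x : {b | f x = inr b}.
    by move: fz; rewrite -(side x); case: (f x) => // a _; exists a.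
  exists (fun x => sval (fr x)) => x y /fP.
  by rewrite {1}(svalP (fr x)) {1}(svalP (fr y)).
Qed.

Fixpoint meet_family (K : nat -> digraph) (C : digraph) (S : pred nat) m :=
  if m is m'.+1 then
    let M := meet_family K C S m' in
    if S m' then prod_digraph M (K m') else M
  else C.

Fixpoint join_family (K : nat -> digraph) (A : digraph) (S : pred nat) m :=
  if m is m'.+1 then
    let J := join_family K A S m' in
    if S m' then sum_digraph J (K m') else J
  else A.

(** The universal properties of [meet_family] and [join_family] are all that the
    comparisons of such digraphs rely on. *)
Lemma le_meet_family K (C : digraph) S m (Z : digraph) :
  hom_le Z (meet_family K C S m) <->
  hom_le Z C /\ forall i, i < m -> S i -> hom_le Z (K i).
Proof.
elim: m => [|m IHm] /=; first by split=> [|[]].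
have split_last : hom_le Z (meet_family K C S m) /\ (S m -> hom_le Z (K m)) <->
    hom_le Z C /\ forall i, i < m.+1 -> S i -> hom_le Z (K i).
  split=> [[/IHm[ZC ZK] Zm]|[ZC ZK]].
    by split=> // i; rewrite ltnS leq_eqVlt => /predU1P[->|/ZK].
  by split; [apply/IHm; split=> // i /ltnW /ZK | apply: ZK].
apply: iff_trans split_last; case: (S m).
  split=> [le_Z|[le_Z le_m]]; last by apply: le_prod => //; apply: le_m.
  by split=> [|_]; apply: hom_le_trans le_Z _; [apply: prod_le1 | apply: prod_le2].
by split=> [|[]].
Qed.

Lemma join_family_le K (A : digraph) S m (Z : digraph) :
  hom_le (join_family K A S m) Z <->
  hom_le A Z /\ forall i, i < m -> S i -> hom_le (K i) Z.
Proof.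
elim: m => [|m IHm] /=; first by split=> [|[]].
have split_last : hom_le (join_family K A S m) Z /\ (S m -> hom_le (K m) Z) <->
    hom_le A Z /\ forall i, i < m.+1 -> S i -> hom_le (K i) Z.
  split=> [[/IHm[AZ KZ] mZ]|[AZ KZ]].
    by split=> // i; rewrite ltnS leq_eqVlt => /predU1P[->|/KZ].
  by split; [apply/IHm; split=> // i /ltnW /KZ | apply: KZ].
apply: iff_trans split_last; case: (S m).
  split=> [le_Z|[le_Z le_m]]; last by apply: sum_le => //; apply: le_m.
  by split=> [|_]; apply: hom_le_trans le_Z; [apply: le_sum1 | apply: le_sum2].
by split=> [|[]].
Qed.

(** * Universality from an independent sequence *)

(** Each index [j] carries a digraph [X j] that remembers only the finitely many
    [l <= j] above [j], and [F i] collects the [X j] for the finitely many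
    [j <= i] below [i].  If [i] is below [i'] in the order and [X j] occurs in
    [F i], then [j] is below [i'], so [X j] occurs in [F i'] unless [i' < j];
    in that case [X i'] occurs there, and it is above [X j].  If [i] is not
    below [i'], then [X j] is below [K j] for every [X j] in [F i'], and such a
    [j] is not above [i]; independence, applied to the set of [l <= i] above
    [i], prevents [X i] from being below [F i']. *)
Lemma universal_of_independent (G H C A : digraph) (K : nat -> digraph) :
  hom_le G H -> hom_le C H -> hom_le G A ->
  (forall S m, ~ hom_le (meet_family K C S m) (join_family K A (predC S) m)) ->
  universal (@interval_le G H).
Proof.
move=> leGH leCH leGA indep P leP [c c_inj] [leP_refl leP_trans _].
(* The order of [P], transported to the range of [c]. *)
pose le i j := `[< exists x y, [/\ c x = i, c y = j & leP x y] >].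
have leE x y : le (c x) (c y) <-> leP x y.
  split=> [/asboolP[x' [y' [/c_inj -> /c_inj ->]]] //|xy].
  by apply/asboolP; exists x, y.
have le_trans j i l : le i j -> le j l -> le i l.
  move=> /asboolP[x [y [<- <- xy]]] /asboolP[y' [z [/c_inj -> <- yz]]].
  exact/leE/(leP_trans _ _ _ xy yz).
have le_refl i j : le i j -> le i i.
  by move=> /asboolP[x [y [<- _ _]]]; apply/leE/leP_refl.
pose X i := meet_family K C (le i) i.+1.
pose F i := join_family X G (le^~ i) i.+1.
have F_in i : hom_le G (F i) /\ hom_le (F i) H.
  have [GF _] := (join_family_le X G (le^~ i) i.+1 (F i)).1 (hom_le_refl _).
  split=> //; apply/join_family_le; split=> // j _ _.
  have [XC _] := (le_meet_family K C (le j) j.+1 (X j)).1 (hom_le_refl _).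
  exact: hom_le_trans XC leCH.
have XK i j : j <= i -> le i j -> hom_le (X i) (K j).
  by have [_] := (le_meet_family K C (le i) i.+1 (X i)).1 (hom_le_refl _); apply.
have XF i j : j <= i -> le j i -> hom_le (X j) (F i).
  by have [_] := (join_family_le X G (le^~ i) i.+1 (F i)).1 (hom_le_refl _); apply.
exists (fun x => exist _ (F (c x)) (F_in (c x))) => x y; rewrite /interval_le /=.
split=> [/leE xy|FxFy].
  apply/join_family_le; split=> [|j _ jx]; first exact: (F_in _).1.
  have jy := le_trans _ _ _ jx xy.
  have [/XF|lt_yj] := leqP j (c y); first exact.
  apply: (@hom_le_trans _ (X (c y))); last by apply: XF => //; apply/leE/leP_refl.
  apply/le_meet_family; split=> [|l ly yl].
    by have [] := (le_meet_family K C (le j) j.+1 (X j)).1 (hom_le_refl _).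
  by apply: XK; [apply: ltnW (leq_trans ly lt_yj) | apply: le_trans yl].
apply/leE; case: (boolP (le (c x) (c y))) => // not_xy; exfalso.
(* [X (c x)] is the meet over [E]; the family is extended to a common length
   that also covers the indices of [F (c y)]. *)
pose E j := (j <= c x) && le (c x) j.
apply: (indep E (maxn (c x) (c y)).+1).
apply: (@hom_le_trans _ (X (c x))).
  have [leC leK] := (le_meet_family K C E (maxn (c x) (c y)).+1 _).1 (hom_le_refl _).
  apply/le_meet_family; split=> // i; rewrite ltnS => ix xi.
  by apply: leK; [rewrite ltnS leq_max ix | apply/andP].
have xx : le (c x) (c x) by apply/leE/leP_refl.
apply: hom_le_trans (XF _ _ (leqnn _) xx) _.
apply: hom_le_trans FxFy _.
have [leA leK] :=
  (join_family_le K A (predC E) (maxn (c x) (c y)).+1 _).1 (hom_le_refl _).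
apply/join_family_le; split=> [|j]; first exact: hom_le_trans leA.
rewrite ltnS => jy le_jy.
apply: hom_le_trans (XK _ _ (leqnn j) (le_refl _ _ le_jy)) _.
apply: leK; first by rewrite ltnS leq_max jy orbT.
rewrite /= /E negb_and; apply/orP; right.
by apply: contra not_xy => /le_trans; apply.
Qed.

(** * Independence of a sparse sequence *)

(** The recursion is the one satisfied by upper bounds for the cardinals of
    [meet_family] and [join_family], whatever the set of indices. *)
Fixpoint stage_bound (kappa : nat -> digraph) b0 m :=
  if m is m'.+1 then
    let b := stage_bound kappa b0 m' in b + #|kappa b| + b * #|kappa b|
  else b0.

(** The last digraph [K m] is eliminated first.  Either it is a factor of the
    meet, and the first hypothesis replaces it by [C], which is already above
    the other factors; or it is a summand of the join, and the second hypothesis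
    absorbs it in [A].  Both apply since [stage_bound] exceeds the cardinals of
    everything built from the earlier digraphs. *)
Lemma meet_not_le_join (kappa : nat -> digraph) (C A : digraph) :
  (forall b (Z W : digraph), #|Z| <= b -> #|W| <= b ->
     hom_le (prod_digraph Z (kappa b)) W -> hom_le (prod_digraph Z C) W) ->
  (forall b (Z B : digraph), #|Z| <= b -> hom_le A B ->
     hom_le Z (sum_digraph B (kappa b)) -> hom_le Z B) ->
  ~ hom_le C A ->
  let K m := kappa (stage_bound kappa (#|C| + #|A|) m) in
  forall S m, ~ hom_le (meet_family K C S m) (join_family K A (predC S) m).
Proof.
move=> cancel absorb not_CA K S.
pose M m := meet_family K C S m; pose J m := join_family K A (predC S) m.
pose b m := stage_bound kappa (#|C| + #|A|) m.
have bM m : #|M m| <= b m.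
  elim: m => [|m IHm]; first exact: leq_addr.
  rewrite /M /= -/(M m); case: (S m); last by rewrite -[b _.+1]addnA (leq_trans IHm) ?leq_addr.
  by rewrite card_prod (leq_trans _ (leq_addl _ _)) // leq_mul.
have bJ m : #|J m| <= b m.
  elim: m => [|m IHm]; first exact: leq_addl.
  rewrite /J /= -/(J m); case: (~~ S m); last by rewrite -[b _.+1]addnA (leq_trans IHm) ?leq_addr.
  by rewrite card_sum (leq_trans _ (leq_addr _ _)) // leq_add.
elim=> [//|m IHm] /=; case: (S m) => /= le_MJ; apply: IHm.
  apply: hom_le_trans (cancel _ _ _ (bM m) (bJ m) le_MJ).
  apply: le_prod; first exact: hom_le_refl.
  by have [] := (le_meet_family K C S m (M m)).1 (hom_le_refl _).
apply: absorb (bM m) _ le_MJ.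
by have [] := (join_family_le K A (predC S) m (J m)).1 (hom_le_refl _).
Qed.

(** * Shift digraphs *)

Definition increasing n : rel 'I_n := fun i j => i < j.
Arguments increasing {n}.

(** An arc is an increasing sequence of length [k + 2]; it goes from its
    initial segment of length [k + 1] to its final one.  Tuples that are not
    increasing are isolated. *)
Definition shift_arc k n : rel (k.+1.-tuple 'I_n) := fun s t =>
  [exists b, sorted increasing (rcons s b) && (behead (rcons s b) == t)].

Lemma shift_arc_irr k n : irreflexive (@shift_arc k n).
Proof.
move=> s; apply/existsP => -[b /andP[]].
case/tupleP: s => a w /=.
case: (val w) => [|x s] /= /andP[+ _] /eqP[eq_a];
  by rewrite /increasing eq_a ltnn.
Qed.

Definition shift_digraph k n := Digraph (@shift_arc_irr k n).

Fixpoint shift_bound k c := if k is k'.+1 then shift_bound k' (2 ^ c) else c.+1.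

Lemma increasing_trans n : transitive (@increasing n).
Proof. by move=> i j l; apply: ltn_trans. Qed.

(** Induction on the length: colour a sequence [w] by the set of colours of its
    increasing extensions [rcons w b].  If [s] and its shift [t] get the same
    set, then the colour of the extension of [s] by the last entry of [t] is also
    the colour of an extension of [t].  Each step thus replaces [c] colours by
    [2 ^ c], and for length 1 the pigeonhole principle applies. *)
Lemma monochromatic_shift (T : finType) k c n (f : seq 'I_n -> T) :
  #|T| <= c -> shift_bound k c <= n ->
  exists s b, [/\ size s = k.+1, sorted increasing (rcons s b) &
                  f s = f (behead (rcons s b))].
Proof.
elim: k => [|k IHk] /= in T c f *.
  move=> Tc cn; have: ~~ injectiveb (fun i => f [:: i]).
    apply/negP => /injectiveP /leq_card; rewrite card_ord => nT.
    by have:= leq_trans (leq_trans cn nT) Tc; rewrite ltnn.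
  case/injectivePn=> i [j ij fij].
  wlog lt_ij : i j {ij} fij / i < j => [IH|].
    by case: (ltngtP i j) => [/IH|/IH|/val_inj eq_ij]; [apply | apply | case/eqP: ij].
  by exists [:: i], j; rewrite /= /increasing lt_ij.
move=> Tc cn.
pose g s := [set f (rcons s b) | b in 'I_n & sorted increasing (rcons s b)].
have [|s [b [s_k s_inc g_eq]]] := IHk {set T} (2 ^ c) g _ cn.
  by rewrite -cardsT -powersetT card_powerset cardsT leq_pexp2l.
have: f (rcons s b) \in g (behead (rcons s b)).
  by rewrite -g_eq; apply: imset_f; rewrite inE.
case/imsetP=> d; rewrite inE => /= d_inc f_eq.
exists (rcons s b), d; rewrite size_rcons s_k; split=> //; last first.
  by rewrite f_eq; case: (s) s_k.
case: s s_k s_inc d_inc {g_eq f_eq} => //= a s _.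
by case: s => [|a' s] /= /andP[-> _].
Qed.

Lemma shift_monochromatic_arc (T : finType) k c
    (f : shift_digraph k (shift_bound k c.+1) -> T) :
  #|T| <= c -> exists s t, arc s t /\ f s = f t.
Proof.
move=> Tc; set n := shift_bound k c.+1 in f *.
(* Sequences that are not vertices get the additional colour [None]. *)
pose f' (s : seq 'I_n) : option T := omap f (insub s).
have [||s [b [s_k s_inc f'_eq]]] := @monochromatic_shift _ k c.+1 n f'.
- by rewrite card_option ltnS.
- by [].
have t_k : size (behead (rcons s b)) == k.+1 by rewrite size_behead size_rcons s_k.
move/eqP: s_k => s_k.
exists (Tuple s_k), (Tuple t_k); split.
  by apply/existsP; exists b; rewrite s_inc /=.
move: f'_eq; rewrite /f' (insubT (fun s => size s == k.+1) s_k).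
by rewrite (insubT (fun s => size s == k.+1) t_k) => -[].
Qed.

(** * Twisting a digraph along an arc *)

Definition twist_arc (H : digraph) (u v : H) (Q : digraph) : rel (H * Q) :=
  fun p q => arc p.1 q.1 &&
    (if (p.1, q.1) == (u, v) then arc p.2 q.2 else p.2 == q.2).

Lemma twist_arc_irr (H : digraph) (u v : H) (Q : digraph) :
  irreflexive (@twist_arc H u v Q).
Proof. by move=> p; rewrite /twist_arc arc_irr. Qed.

Definition twist (H : digraph) (u v : H) (Q : digraph) :=
  Digraph (@twist_arc_irr H u v Q).

Lemma neqb_irr : irreflexive (fun a b : bool => a != b).
Proof. by move=> a; rewrite eqxx. Qed.

Definition K2 := Digraph neqb_irr.

(** The colour of a vertex [s] of the shift digraph is the map obtained by fixing
    the coordinate [s]; the number of such maps determines how large the shift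
    digraph has to be. *)
Lemma twist_cancel (H Z W : digraph) (u v : H) k c :
  #|W| ^ (#|Z| * #|H|) <= c ->
  hom_le (prod_digraph Z (twist u v (shift_digraph k (shift_bound k c.+1)))) W ->
  hom_le (prod_digraph Z H) W.
Proof.
move=> le_c [f fP].
pose color s := [ffun p : Z * H => f (p.1, (p.2, s))].
have [|s [t [st eq_st]]] := @shift_monochromatic_arc _ k c color.
  by rewrite card_ffun card_prod.
have eq_f z x : f (z, (x, s)) = f (z, (x, t)).
  by move/ffunP/(_ (z, x)): eq_st; rewrite !ffunE.
exists (fun p => f (p.1, (p.2, s))) => -[z x] [z' x'] /andP[/= zz' xx'].
case: (altP ((x, x') =P (u, v))) => [e_uv|not_uv].
  by rewrite (eq_f z'); apply: fP; rewrite /= /prod_arc /= /twist_arc /= zz' xx' e_uv eqxx.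
by apply: fP; rewrite /= /prod_arc /= /twist_arc /= zz' xx' (negPf not_uv) eqxx.
Qed.

(** Let [F] be the set of first entries of the vertices [s] of the shift digraph
    that are hit by [Z].  It has at most [k] elements, so that an increasing
    [s], having [k + 1] distinct entries, has one outside [F].  Shifting a hit sequence
    moves its first entry outside [F] by exactly one place, because the entry
    that is dropped belongs to [F].  The parity of that place is thus a proper
    2-colouring. *)
Lemma sum_twist_shift_local (H Z B : digraph) (u v : H) k n :
  #|Z| <= k -> hom_le Z (sum_digraph B (twist u v (shift_digraph k n))) ->
  hom_le Z (sum_digraph B (twist u v K2)).
Proof.
move=> Zk [f fP].
pose first z := if f z is inr p then Some (thead p.2) else None.
(* [N] is the complement of the set of first entries that are hit. *)
pose N : pred 'I_n := fun a => Some a \notin [set first z | z in Z].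
pose parity (s : shift_digraph k n) : K2 := odd (find N s).
have parityP (s t : shift_digraph k n) : arc s t -> Some (thead s) \in [set first z | z in Z] ->
    parity s != parity t.
  move=> /existsP[b /andP[s_inc /eqP s_t]] s_N.
  have has_N : has N s.
    apply/negPn/negP => /hasPn s_sub.
    have: #|[set Some a | a in s]| <= #|[set first z | z in Z]|.
      apply/subset_leq_card/subsetP => _ /imsetP[a /s_sub + ->].
      by rewrite /N negbK.
    rewrite card_imset; last by move=> a a' [].
    move/leq_trans/(_ (leq_imset_card _ _)); rewrite leqNgt => /negP; apply.
    have s_uniq : uniq s.
      have:= sorted_uniq (@increasing_trans n) _ s_inc.
      by rewrite rcons_uniq => uq; case/andP: (uq (fun i => ltnn i)).
    by rewrite (card_uniqP s_uniq) size_tuple ltnS.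
  rewrite /parity -{}s_t; case/tupleP: s s_N has_N {s_inc} => a w a_N.
  have {a_N} Na : N a = false by rewrite /N -[a in Some a](theadE a w) a_N.
  by rewrite /= Na -cats1 find_cat /= => -> /=; case: (odd _).
exists (fun z => match f z with
  | inl x => inl x | inr p => inr (p.1, parity p.2) end).
move=> x y /fP; have:= erefl (first x); rewrite {1}/first /=.
case: (f x) (f y) => [a|[h s]] [a'|[h' s']] //= fx.
rewrite /twist_arc /=; case/andP=> -> /=.
case: ifP => _; last by move/eqP->.
by move/parityP; apply; rewrite fx; apply: imset_f.
Qed.

Lemma twist_K2_absorb (H Z B : digraph) (u v : H) k n :
  #|Z| <= k -> hom_le (twist u v K2) B ->
  hom_le Z (sum_digraph B (twist u v (shift_digraph k n))) -> hom_le Z B.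
Proof.
move=> Zk DB /(sum_twist_shift_local Zk) ZBD; apply: hom_le_trans ZBD _.
by apply: sum_le => //; apply: hom_le_refl.
Qed.

(** * Arcs of a core that lie on a cycle *)

Definition avoiding (G : digraph) (u v : G) : rel G := fun x y =>
  (arc x y && ((x, y) != (u, v))) || (arc y x && ((y, x) != (u, v))).

(** The arc is the first one of the cycle; the others are different from it and
    lead around the cycle from one of its ends to the other.  For two opposite
    arcs the second one alone does so, since only the arc itself is avoided and
    not the pair of its ends. *)
Lemma cycle_nonbridge (G : digraph) : contains_cycle G ->
  exists u v : G, arc u v /\ connect (avoiding u v) u v.
Proof.
case=> k [v [e [k_gt0 v_k _ e_inj eP]]].
have [arc0 e0] := eP 0 k_gt0; exists (e 0).1, (e 0).2; split=> //.
set R := avoiding _ _.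
have R_sym : connect_sym R by apply: sym_connect_sym => x y; rewrite /R /avoiding orbC.
have walk i : 0 < i <= k -> connect R (v 1) (v i).
  case: i => // i; elim: i => [_|i IHi /= ik]; first exact: connect0.
  apply: connect_trans (IHi (ltnW ik)) (connect1 _).
  have [arc_i ei] := eP _ ik.
  have ne: ((e i.+1).1, (e i.+1).2) != ((e 0).1, (e 0).2).
    by rewrite -!surjective_pairing; apply/eqP => /e_inj; rewrite !inE => /(_ ik k_gt0).
  by move: arc_i ne; rewrite /R /avoiding; case: ei => -> /= -> ->; rewrite ?orbT.
have v10 : connect R (v 1) (v 0) by rewrite -v_k; apply: walk; rewrite k_gt0 leqnn.
by move: v10; case: e0 => -> /=; rewrite // R_sym.
Qed.

Definition induced_arcs (H : digraph) (C : subgraph H) (S : {set C}) :=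
  [set a in sub_arcs C | (a.1 \in val @: S) && (a.2 \in val @: S)].

Lemma induced_arcsP (H : digraph) (C : subgraph H) (S : {set C}) a :
  a \in induced_arcs S -> [/\ arc a.1 a.2, a.1 \in val @: S & a.2 \in val @: S].
Proof. by rewrite inE => /andP[/sub_arcsP[]] ? _ _ /andP[]. Qed.

Definition induced (H : digraph) (C : subgraph H) (S : {set C}) :=
  Subgraph (@induced_arcsP H C S).

(** By minimality the subgraph induced on the image contains all vertices, and a
    surjective map of a finite set to itself is injective. *)
Lemma core_endo_inj (H : digraph) (C : subgraph H) (f : C -> C) :
  is_core C -> {homo f : x y / arc x y >-> arc x y} -> injective f.
Proof.
move=> [[leCH leHC] C_min] fP.
pose K := induced (f @: setT).
have KC : subgraph_le K C.
  split; apply/subsetP => a; last by rewrite [_ \in _]inE => /andP[].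
  by case/imsetP=> x _ ->; apply: valP.
have KH : hom_equiv K H.
  split; first by exists val => x y /sub_arcsP[].
  apply: hom_le_trans leHC _.
  have fK x : val (f x) \in sub_vertices K by apply: imset_f; apply: imset_f.
  exists (fun x => (exist (fun a => a \in sub_vertices K) _ (fK x) : K)) => x y /fP xy.
  by rewrite /= /sub_arc /= inE; apply/and3P; split=> //; apply: fK.
have [/subsetP CK _] := C_min K KC KH.
have onto : f @: setT = setT.
  apply/setP => x; rewrite in_setT; case/imsetP: (CK _ (valP x)) => y y_f.
  by move/val_inj->.
have /imset_injP f_inj : #|f @: setT| == #|[set: C]| by rewrite onto.
by move=> x y; apply: f_inj; rewrite in_setT.
Qed.

(** Composed with a power of the automorphism [f], the homomorphism [h] becomes a
    section of the projection, and [layer] is its second coordinate. *)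
Lemma core_not_le_twist (H : digraph) (C : subgraph H) (u v : C) (Q : digraph) :
  is_core C -> arc u v -> connect (avoiding u v) u v -> ~ hom_le C (twist u v Q).
Proof.
move=> C_core uv conn [h hP].
pose f x := (h x).1.
have fP : {homo f : x y / arc x y >-> arc x y} by move=> x y /hP /andP[].
pose s := perm (core_endo_inj C_core fP).
have sX_hom m : {homo (s ^+ m)%g : x y / arc x y >-> arc x y}.
  elim: m => [|m IHm] x y xy; first by rewrite expg0 !perm1.
  by rewrite expgSr !permM !permE; apply/fP/IHm.
(* [r] is the inverse of [s], in a form that is visibly a homomorphism. *)
pose r := (s ^+ #[s]%g.-1)%g.
have fr x : f (r x) = x.
  by rewrite -[f _](permE (core_endo_inj C_core fP)) -/s -permM -expgSr prednK ?order_gt0 // expg_order perm1.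
pose layer x := (h (r x)).2.
have arcP x y : arc x y ->
    if (x, y) == (u, v) then arc (layer x) (layer y) else layer x == layer y.
  move=> /(sX_hom #[s]%g.-1) /hP /andP[_].
  by rewrite -[(h _).1]/(f _) -[(h (_ y)).1]/(f _) !fr.
have step x y : avoiding u v x y -> layer x = layer y.
  by case/orP=> /andP[/arcP + /negPf ne]; rewrite ne => /eqP.
have same_layer x y : connect (avoiding u v) x y -> layer x = layer y.
  by case/connectP=> p + ->; elim: p x => //= z p IHp x /andP[/step-> /IHp].
by have:= arcP u v uv; rewrite eqxx (same_layer _ _ conn) arc_irr.
Qed.

(** * The interval below a connected core with a cycle *)

Theorem theorem1p3 (G H : digraph) (C : subgraph H) :
  hom_lt G H ->
  is_core C ->
  connected C ->
  contains_cycle C ->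
  universal (@interval_le G H).
Proof.
move=> [leGH not_HG] C_core C_conn /cycle_nonbridge[u [v [uv u_v]]].
have [leCH leHC] := C_core.1.
(* For [#|Z|] and [#|W|] at most [b], the power of [b.+1] bounds the number of
   maps from the product of [Z] and [C] to [W]. *)
pose kappa b :=
  twist u v (shift_digraph b (shift_bound b (b.+1 ^ (b * #|C|)).+1)).
pose D := twist u v K2.
pose A := sum_digraph G D.
apply: (@universal_of_independent G H C A
          (fun m => kappa (stage_bound kappa (#|C| + #|A|) m))) => //.
  exact: le_sum1.
apply: (@meet_not_le_join kappa C A).
- move=> b Z W Zb Wb; apply: twist_cancel.
  apply: (@leq_trans (b.+1 ^ (#|Z| * #|C|))).
    by case: (posnP (#|Z| * #|C|)) => [->|e_gt0] //; rewrite leq_exp2r // leqW.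
  by rewrite leq_pexp2l // leq_mul.
- move=> b Z B Zb leAB; apply: twist_K2_absorb => //.
  exact: hom_le_trans (le_sum2 _ _) leAB.
case/(connected_le_sum u C_conn) => [leCG|].
  exact: not_HG (hom_le_trans leHC leCG).
exact: core_not_le_twist C_core uv u_v.
Qed.
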